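(* Let $(\Omega,\mu)$ be a measure space, $W\subset\Omega$ a set of sample points, $\mathcal{X}$ a set, and $\mathcal{G}\subset L_2(\Omega,\mu)$ a continuously embedded reproducing kernel Hilbert space over $\Omega$ with reproducing kernel $G$. Let $k:\mathcal{X}\times\Omega\to\mathbb{C}$ be such that $k(x,\cdot)\in L_2(\Omega,\mu)$ for every $x\in\mathcal{X}$, and let $S$ be the integral transform $(Sa)(x)=\int_\Omega a(\omega)k(x,\omega)\,d\mu(\omega)$, $a\in L_2(\Omega,\mu)$, $x\in\mathcal{X}$ (so that $S(L_2(\Omega,\mu))$ is the reproducing kernel Hilbert space over $\mathcal{X}$ with kernel $K(x,y)=\int_\Omega k(x,\omega)\overline{k(y,\omega)}\,d\mu(\omega)$). Let $P_W$ be the power function corresponding to $W$, with $P_W\in L_2(\Omega,\mu)$. Then for every $a\in\mathcal{G}$, with minimum-norm interpolator $a_W$ of $a$ on $W$, and every $x\in\mathcal{X}$, $$|S(a)(x)-S(a_W)(x)|\le\|a\|_{\mathcal{G}}\,\|P_W\|_{L_2(\Omega,\mu)}\,\|k(x,\cdot)\|_{L_2(\Omega,\mu)}.$$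
   Context: A reproducing kernel Hilbert space over $\Omega$ with reproducing kernel $G$ is a Hilbert space $\mathcal{G}$ of functions $\Omega\to\mathbb{C}$ with $G(\cdot,\omega)\in\mathcal{G}$ and $a(\omega)=\langle a,G(\cdot,\omega)\rangle_{\mathcal{G}}$ for all $a\in\mathcal{G}$, $\omega\in\Omega$. Continuously embedded in $L_2(\Omega,\mu)$ means that every element of $\mathcal{G}$ is a measurable square-integrable function and the inclusion $\mathcal{G}\to L_2(\Omega,\mu)$ is continuous. Let $\mathcal{G}_W$ be the closed subspace of $\mathcal{G}$ generated by $\{G(\cdot,\omega):\omega\in W\}$ and $G_W$ its reproducing kernel. The power function $P_W:\Omega\to[0,\infty)$ is given by $P_W(\omega)^2=G(\omega,\omega)-G_W(\omega,\omega)$. For $a\in\mathcal{G}$, the minimum-norm interpolator $a_W$ is the unique element of $\mathcal{G}_W$ with $a_W(\omega)=a(\omega)$ for all $\omega\in W$; equivalently, the element of $\mathcal{G}$ of minimal norm with these values on $W$. *)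

(* Defs.v *)
From HB Require Import structures.
From mathcomp Require Import all_boot all_order all_algebra.
From mathcomp Require Import all_classical all_reals all_analysis.
From mathcomp Require Import complex.

Set Implicit Arguments.
Unset Strict Implicit.
Unset Printing Implicit Defensive.
Import Order.TTheory GRing.Theory Num.Theory.
Import numFieldNormedType.Exports.

Local Open Scope classical_set_scope.
Local Open Scope ring_scope.
Local Open Scope complex_scope.

Definition measurable_cfun (R : realType) (d : measure_display)
    (Omega : measurableType d) (f : Omega -> R[i]) : Prop :=
  measurable_fun [set: Omega] (fun w => complex.Re (f w)) /\
  measurable_fun [set: Omega] (fun w => complex.Im (f w)).

Definition integralC (R : realType) (d : measure_display)
    (Omega : measurableType d) (mu : {measure set Omega -> \bar R})
    (f : Omega -> R[i]) : R[i] :=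
  Rintegral mu setT (fun w => complex.Re (f w)) +i*
  Rintegral mu setT (fun w => complex.Im (f w)).

(* Norms over the field [R[i]] (in particular the modulus of [R[i]] itself) take
   values in [R[i]], with zero imaginary part. *)
Definition rnorm (R : realType) (V : normedZmodType R[i]) (v : V) : R :=
  complex.Re `|v|.

Definition L2norm (R : realType) (d : measure_display)
    (Omega : measurableType d) (mu : {measure set Omega -> \bar R})
    (f : Omega -> R[i]) : \bar R :=
  Lnorm mu 2%:E (fun w => (rnorm (f w))%:E).

(* Membership in L_2 is a property of functions, not of classes modulo
   almost everywhere equality: elements of an RKHS have point values. *)
Definition L2 (R : realType) (d : measure_display)
    (Omega : measurableType d) (mu : {measure set Omega -> \bar R})
    (f : Omega -> R[i]) : Prop :=
  measurable_cfun f /\ (L2norm mu f < +oo)%E.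

(* [V] is a closed subspace, [K] its kernel; [V = setT] for the whole space. *)
Definition reproducing_kernel (R : realType) (Omega : Type)
    (H : completeNormedModType R[i]) (ip : {dot H for (@Num.conj R[i])})
    (ev : H -> Omega -> R[i]) (V : set H) (K : Omega -> Omega -> R[i]) : Prop :=
  forall w : Omega, exists g : H,
    [/\ V g, ev g = (fun z => K z w) & forall a, V a -> ev a w = ip a g].

(* The Hilbert space [H] consists of functions on [Omega]: [ev a] is the
   function that [a : H] is, hence linearity and injectivity of [ev].
   [ip] is linear in its first argument, conjugate-linear in the second. *)
Record rkhs (R : realType) (Omega : Type)
    (H : completeNormedModType R[i]) (ip : {dot H for (@Num.conj R[i])})
    (ev : H -> Omega -> R[i]) (G : Omega -> Omega -> R[i]) : Prop := {
  rkhs_norm : forall a : H, `|a| ^+ 2 = ip a a;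
  rkhs_linear : forall (c : R[i]) (a b : H) (w : Omega),
    ev (c *: a + b) w = c * ev a w + ev b w;
  rkhs_inj : injective ev;
  rkhs_kernel : reproducing_kernel ip ev setT G }.

Definition continuously_embedded (R : realType) (d : measure_display)
    (Omega : measurableType d) (mu : {measure set Omega -> \bar R})
    (H : completeNormedModType R[i]) (ev : H -> Omega -> R[i]) : Prop :=
  (forall a : H, L2 mu (ev a)) /\
  (forall a : H,
    L2norm mu (fun w => ev b w - ev a w) @[b --> a] --> (0 : \bar R)%E).

Definition closed_span (R : realType) (H : completeNormedModType R[i])
    (A : set H) : set H :=
  smallest (fun V : set H => closed V /\ submod_closed [in V]) A.

Definition sample_space (R : realType) (Omega : Type)
    (H : completeNormedModType R[i]) (ev : H -> Omega -> R[i])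
    (G : Omega -> Omega -> R[i]) (W : set Omega) : set H :=
  closed_span [set g : H | exists2 w, W w & ev g = (fun z => G z w)].

(* This determines [P]: the kernel [GW] of the closed subspace is unique. *)
Definition power_function (R : realType) (Omega : Type)
    (H : completeNormedModType R[i]) (ip : {dot H for (@Num.conj R[i])})
    (ev : H -> Omega -> R[i]) (G : Omega -> Omega -> R[i]) (W : set Omega)
    (P : Omega -> R) : Prop :=
  exists2 GW : Omega -> Omega -> R[i],
    reproducing_kernel ip ev (sample_space ev G W) GW &
    forall w, 0 <= P w /\ ((P w) ^+ 2)%:C = G w w - GW w w.

(* The subspace [sample_space] contains exactly one such [aW], which has minimal
   norm among all elements of [H] agreeing with [a] on [W]. *)
Definition min_norm_interpolator (R : realType) (Omega : Type)
    (H : completeNormedModType R[i]) (ev : H -> Omega -> R[i])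
    (G : Omega -> Omega -> R[i]) (W : set Omega) (a aW : H) : Prop :=
  sample_space ev G W aW /\ forall w, W w -> ev aW w = ev a w.

Definition integral_transform (R : realType) (d : measure_display)
    (Omega : measurableType d) (mu : {measure set Omega -> \bar R})
    (X : Type) (k : X -> Omega -> R[i]) (f : Omega -> R[i]) (x : X) : R[i] :=
  integralC mu (fun w => f w * k x w).

(* Main.v *)
Require Import Defs.
From HB Require Import structures.
From mathcomp Require Import all_boot all_order all_algebra.
From mathcomp Require Import all_classical all_reals all_analysis.
From mathcomp Require Import complex.
From mathcomp Require Import measurable_realfun.
Import Order.TTheory GRing.Theory Num.Theory.
Import numFieldNormedType.Exports.
Local Open Scope classical_set_scope.
Local Open Scope ring_scope.
Local Open Scope complex_scope.

(** The estimate follows by integrating a pointwise one. Fix a point w and put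
c := a - aW. As c vanishes on the sample points W, the reproducing property
makes it orthogonal to every generator of the sample space V, hence to V itself,
the orthogonal complement of c being a closed subspace
([closed_span_orthogonal]). Let g and h represent evaluation at w on the whole
space and on V respectively; h is the orthogonal projection of g onto V. Then
c(w) = <c, g> = <c, g - h> because c is orthogonal to h, and <aW, g - h> = 0
because g and h represent the same functional on V, so c(w) = <a, g - h>.
Expanding |g - h|^2 by reproducing identities gives G(w, w) - GW(w, w), that is
PW(w)^2, so the Cauchy-Schwarz inequality yields |c(w)| <= |a| PW(w)
([power_function_bound]).

The integrands a k(x, .) and aW k(x, .) are integrable, being products of square
integrable functions ([L2_integrableCM]), so the difference of the transforms is
the integral of c k(x, .), which is at most the integral of |c| |k(x, .)|
([le_rnorm_integralC]). The pointwise bound and the Hoelder inequality with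
exponents 2 and 2 ([integral_rnormM_le]) conclude. *)

Set Implicit Arguments.
Unset Strict Implicit.

(** * The real-valued norm *)

Lemma rnorm_complexE (R : realType) (z : R[i]) :
  rnorm z = Num.sqrt ((complex.Re z) ^+ 2 + (complex.Im z) ^+ 2).
Proof. by rewrite /rnorm normc_def. Qed.

Lemma real_complex_rnorm (R : realType) (V : normedZmodType R[i]) (v : V) :
  (rnorm v)%:C = `|v|.
Proof. by apply: RRe_real; rewrite ger0_real. Qed.

Lemma rnorm_ge0 (R : realType) (V : normedZmodType R[i]) (v : V) :
  0 <= rnorm v.
Proof. by rewrite -ler0c real_complex_rnorm. Qed.

Lemma rnormM (R : realType) (y z : R[i]) : rnorm (y * z) = rnorm y * rnorm z.
Proof. by apply: complexI; rewrite rmorphM/= !real_complex_rnorm normrM. Qed.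

Lemma ler_rnorm_Re (R : realType) (z : R[i]) : `|complex.Re z| <= rnorm z.
Proof. by rewrite -lecR real_complex_rnorm normc_ge_Re. Qed.

Lemma ler_rnorm_Im (R : realType) (z : R[i]) : `|complex.Im z| <= rnorm z.
Proof.
by rewrite rnorm_complexE -sqrtr_sqr ler_wsqrtr// lerDr sqr_ge0.
Qed.

(** The left-hand side is the Euclidean inner product of y and z as vectors of
    the plane, that is the real part of y times the conjugate of z. *)
Lemma Re_Im_le_rnorm (R : realType) (y z : R[i]) :
  complex.Re y * complex.Re z + complex.Im y * complex.Im z
    <= rnorm y * rnorm z.
Proof.
have -> : complex.Re y * complex.Re z + complex.Im y * complex.Im z =
    complex.Re (y * z^*%C) by case: y z => [a b] [c e]/=; rewrite mulrN opprK.
apply: (le_trans (ler_norm _)); apply: (le_trans (ler_rnorm_Re _)).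
by rewrite rnormM /rnorm normcJ.
Qed.

(** * Inner products and orthogonality in arbitrary dimension *)

(** The vector u splits into a multiple t v and a remainder orthogonal to v;
    discarding the remainder in Pythagoras' identity gives the inequality. *)
Lemma dot_CauchySchwarz (C : numClosedFieldType) (U : lmodType C)
    (form : {dot U for (@Num.conj C)}) (u v : U) :
  `|form u v| ^+ 2 <= form u u * form v v.
Proof.
have [->|v0] := eqVneq v 0.
  by rewrite linear0r normr0 expr0n mulr_ge0 ?dnorm_ge0.
have vv0 : 0 < form v v by rewrite dnorm_gt0.
pose t := form u v / form v v; pose r := u - t *: v.
have rv : form r v = 0.
  by rewrite linearBl /= linearZl_LR /= divfK ?subrr// gt_eqF.
have -> : form u u = form r r + `|t| ^+ 2 * form v v.
  have {1 2}-> : u = r + t *: v by rewrite subrK.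
  rewrite hnormDd/= ?dnormZ// linearZr_LR/=.
  by rewrite [X in _ * X]rv mulr0.
have -> : form u v = t * form v v by rewrite divfK// gt_eqF.
rewrite normrM exprMn (ger0_norm (ltW vv0)) mulrDl.
rewrite -[in leRHS]mulrA -[form v v * form v v]expr2 lerDr.
by rewrite mulr_ge0// dnorm_ge0.
Qed.

Lemma normr_dot_le (C : numClosedFieldType) (H : normedModType C)
    (ip : {dot H for (@Num.conj C)}) (ip_norm : forall a, `|a| ^+ 2 = ip a a)
    (u v : H) :
  `|ip u v| <= `|u| * `|v|.
Proof.
rewrite -(@ler_pXn2r _ 2)// ?nnegrE ?mulr_ge0// exprMn !ip_norm.
exact: dot_CauchySchwarz.
Qed.

(** By Cauchy-Schwarz the form is Lipschitz in its first argument, so a limit of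
    vectors orthogonal to c is orthogonal to c. *)
Lemma closed_orthogonal (C : numClosedFieldType) (H : normedModType C)
    (ip : {dot H for (@Num.conj C)}) (ip_norm : forall a, `|a| ^+ 2 = ip a a)
    (c : H) :
  closed [set v | ip v c = 0].
Proof.
move=> v clv; apply/eqP; apply/negP => /negP; rewrite -normr_gt0 => vc_gt0.
(* adding 1 keeps the radius below positive when c = 0 *)
have c1 : 0 < `|c| + 1 by rewrite ltr_wpDl.
have e0 : 0 < `|ip v c| / (`|c| + 1) by rewrite divr_gt0.
have [u [/= uc]] := clv _ (nbhsx_ballx v _ e0).
rewrite -ball_normE /= => vu.
have : `|ip v c| <= `|ip v c| / (`|c| + 1) * `|c|.
  rewrite -[in leLHS](subrK u v) linearDl /= uc addr0.
  by rewrite (le_trans (normr_dot_le ip_norm _ _))// ler_wpM2r// ltW.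
rewrite mulrAC ler_pdivlMr// ler_pM2l// gerDl => h.
by have := lt_le_trans ltr01 h; rewrite ltxx.
Qed.

(** The orthogonal complement of c is one of the closed subspaces containing A
    whose intersection is the closed span. *)
Lemma closed_span_orthogonal (R : realType) (H : completeNormedModType R[i])
    (ip : {dot H for (@Num.conj R[i])}) (ip_norm : forall a, `|a| ^+ 2 = ip a a)
    (A : set H) (c : H) :
  (forall v, A v -> ip c v = 0) ->
  forall v, closed_span A v -> ip c v = 0.
Proof.
have swap_ip u v : ip u v = 0 -> ip v u = 0.
  by move=> uv; rewrite hermC/= uv rmorph0 mulr0.
(* the vectors are put in the linear argument of ip, where the complement is
   visibly a subspace *)
move=> cA v Av; apply: (swap_ip v c); apply: (Av [set u | ip u c = 0]).
split; last by move=> u /cA cu; apply: (swap_ip c u).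
split; first exact: closed_orthogonal.
split; first by rewrite inE/= linear0l.
move=> t u w; rewrite !inE/= => uc wc.
by rewrite linearDl/= linearZl_LR/= uc wc mulr0 addr0.
Qed.

(** * The pointwise error bound *)

(** PW(w) is the distance between the representers g and h of the evaluation at
    w on the whole space and on the sample space, and the error of the
    interpolator at w is the inner product of a with g - h. *)
Lemma power_function_bound (R : realType) (Omega : Type) (W : set Omega)
    (H : completeNormedModType R[i]) (ip : {dot H for (@Num.conj R[i])})
    (ev : H -> Omega -> R[i]) (G : Omega -> Omega -> R[i]) (PW : Omega -> R)
    (hG : rkhs ip ev G) (hPW : power_function ip ev G W PW)
    (a aW : H) (haW : min_norm_interpolator ev G W a aW) (w : Omega) :
  rnorm (ev a w - ev aW w) <= rnorm a * PW w.
Proof.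
have [GW hGW /(_ w) [PW_ge0 PW_sq]] := hPW.
have [VaW aW_a] := haW.
have [g [_ evg repg]] := rkhs_kernel hG w.
have [h [Vh evh reph]] := hGW w.
have evE b : ev b w = ip b g by exact: repg.
have hermE u v : ip u v = Num.conj (ip v u) by rewrite hermC/= mul1r.
have hh : ip h h = GW w w by rewrite -reph// evh.
have hg : ip h g = GW w w by rewrite -evE evh.
have gh : ip g h = GW w w by rewrite hermE hg -hh -hermE.
have dist_sq : `|g - h| ^+ 2 = ((PW w) ^+ 2)%:C.
  rewrite (rkhs_norm hG) PW_sq linearBl/= !linearBr/= hh hg gh -evE evg.
  by rewrite subrr subr0.
have dist : `|g - h| = (PW w)%:C.
  by apply/eqP; rewrite -(@eqrXn2 _ 2)// ?dist_sq ?rmorphXn ?ler0c.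
have aWgh : ip aW (g - h) = 0 by rewrite linearBr/= -evE -reph// subrr.
have ah : ip (a - aW) h = 0.
  apply: closed_span_orthogonal Vh; first exact: rkhs_norm hG.
  move=> v [w' Ww' evv].
  have [g' [_ evg' repg']] := rkhs_kernel hG w'.
  have -> : v = g' by apply: (rkhs_inj hG); rewrite evv evg'.
  by rewrite linearBl/= -!repg'// aW_a// subrr.
have -> : ev a w - ev aW w = ip a (g - h).
  move: ah; rewrite linearBl/= => /eqP; rewrite subr_eq0 => /eqP ah.
  by rewrite !evE linearBr/= ah -reph// evE.
rewrite -lecR rmorphM/= !real_complex_rnorm -dist.
apply: normr_dot_le; exact: rkhs_norm hG.
Qed.

(** * Measurability and integration of complex functions *)

Lemma measurable_rnorm (R : realType) (d : measure_display)
    (Omega : measurableType d) (f : Omega -> R[i]) :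
  measurable_cfun f -> measurable_fun [set: Omega] (fun w => rnorm (f w)).
Proof.
move=> [mRe mIm]; under eq_fun do rewrite rnorm_complexE.
apply: (@measurableT_comp _ _ _ _ _ _ (@Num.sqrt R)).
  by apply: continuous_measurable_fun; exact: sqrt_continuous.
by apply: measurable_funD; apply: measurable_funX.
Qed.

Lemma measurable_cfunM (R : realType) (d : measure_display)
    (Omega : measurableType d) (f g : Omega -> R[i]) :
  measurable_cfun f -> measurable_cfun g ->
  measurable_cfun (fun w => f w * g w).
Proof.
move=> [mRf mIf] [mRg mIg].
have ReM y z : complex.Re (y * z) =
    complex.Re y * complex.Re z - complex.Im y * complex.Im z :> R
  by case: y; case: z.
have ImM y z : complex.Im (y * z) =
    complex.Re y * complex.Im z + complex.Im y * complex.Re z :> R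
  by case: y; case: z.
split.
  under eq_fun do rewrite ReM.
  by apply: measurable_funB; apply: measurable_funM.
under eq_fun do rewrite ImM.
by apply: measurable_funD; apply: measurable_funM.
Qed.

Lemma measurable_cfunB (R : realType) (d : measure_display)
    (Omega : measurableType d) (f g : Omega -> R[i]) :
  measurable_cfun f -> measurable_cfun g ->
  measurable_cfun (fun w => f w - g w).
Proof.
move=> [mRf mIf] [mRg mIg].
have ReB y z : complex.Re (y - z) = complex.Re y - complex.Re z :> R
  by case: y; case: z.
have ImB y z : complex.Im (y - z) = complex.Im y - complex.Im z :> R
  by case: y; case: z.
split.
  by under eq_fun do rewrite ReB; apply: measurable_funB.
by under eq_fun do rewrite ImB; apply: measurable_funB.
Qed.

(** Absolute integrability, phrased through the modulus since this is what the
    Hoelder inequality provides. *)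
Definition integrableC (R : realType) (d : measure_display)
    (Omega : measurableType d) (mu : {measure set Omega -> \bar R})
    (f : Omega -> R[i]) : Prop :=
  measurable_cfun f /\ mu.-integrable setT (fun w => (rnorm (f w))%:E).

Lemma integrableC_Re (R : realType) (d : measure_display)
    (Omega : measurableType d) (mu : {measure set Omega -> \bar R})
    (f : Omega -> R[i]) :
  integrableC mu f -> mu.-integrable setT (EFin \o (@complex.Re R \o f)).
Proof.
move=> [[mRe _] intf]; apply: le_integrable intf => //.
  exact/measurable_EFinP.
by move=> w _ /=; rewrite lee_fin (ger0_norm (rnorm_ge0 _)) ler_rnorm_Re.
Qed.

Lemma integrableC_Im (R : realType) (d : measure_display)
    (Omega : measurableType d) (mu : {measure set Omega -> \bar R})
    (f : Omega -> R[i]) :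
  integrableC mu f -> mu.-integrable setT (EFin \o (@complex.Im R \o f)).
Proof.
move=> [[_ mIm] intf]; apply: le_integrable intf => //.
  exact/measurable_EFinP.
by move=> w _ /=; rewrite lee_fin (ger0_norm (rnorm_ge0 _)) ler_rnorm_Im.
Qed.

Lemma integralCB (R : realType) (d : measure_display)
    (Omega : measurableType d) (mu : {measure set Omega -> \bar R})
    (f g : Omega -> R[i]) :
  integrableC mu f -> integrableC mu g ->
  integralC mu f - integralC mu g = integralC mu (fun w => f w - g w).
Proof.
move=> intf intg; rewrite /integralC.
have -> : Rintegral mu setT (fun w => complex.Re (f w - g w)) =
    Rintegral mu setT (@complex.Re R \o f)
    - Rintegral mu setT (@complex.Re R \o g).
  rewrite -RintegralB//; [|exact: integrableC_Re..].
  by apply: eq_Rintegral => w _ /=; case: (f w); case: (g w).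
have -> : Rintegral mu setT (fun w => complex.Im (f w - g w)) =
    Rintegral mu setT (@complex.Im R \o f)
    - Rintegral mu setT (@complex.Im R \o g).
  rewrite -RintegralB//; [|exact: integrableC_Im..].
  by apply: eq_Rintegral => w _ /=; case: (f w); case: (g w).
by [].
Qed.

(** For z the integral of f, |z|^2 is the integral of the Euclidean product
    of the constant z with f, hence at most |z| times the integral of |f|; it
    remains to divide by |z|. *)
Lemma le_rnorm_integralC (R : realType) (d : measure_display)
    (Omega : measurableType d) (mu : {measure set Omega -> \bar R})
    (f : Omega -> R[i]) :
  integrableC mu f ->
  ((rnorm (integralC mu f))%:E <= \int[mu]_w (rnorm (f w))%:E)%E.
Proof.
move=> intf; have iRe := integrableC_Re intf.
have iIm := integrableC_Im intf; have [_ inorm] := intf.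
rewrite -[leRHS]fineK; last exact: integrable_fin_num.
rewrite lee_fin; set z := integralC mu f.
set N := Rintegral mu setT (fun w => rnorm (f w)); rewrite -[leRHS]/N.
have [z0|zneq0] := eqVneq (rnorm z) 0.
  by rewrite z0; apply: Rintegral_ge0 => w _; exact: rnorm_ge0.
have z_gt0 : 0 < rnorm z by rewrite lt_neqAle eq_sym zneq0 rnorm_ge0.
rewrite -(ler_pM2l z_gt0) -expr2.
have -> : rnorm z ^+ 2 = complex.Re z * Rintegral mu setT (@complex.Re R \o f)
                       + complex.Im z * Rintegral mu setT (@complex.Im R \o f).
  rewrite rnorm_complexE sqr_sqrtr ?addr_ge0 ?sqr_ge0//.
have iZ (r : R) (h : Omega -> R) : mu.-integrable setT (EFin \o h) ->
    mu.-integrable setT (EFin \o (fun w => r * h w)).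
  by move=> /(integrableZl measurableT r).
rewrite -!RintegralZl// -RintegralD//; [|exact: iZ..].
apply: le_Rintegral => //; last by move=> w _; exact: Re_Im_le_rnorm.
- have := integrableD measurableT
    (iZ (complex.Re z) _ iRe) (iZ (complex.Im z) _ iIm).
  exact.
- exact: iZ.
Qed.

Lemma integral_rnormM_le (R : realType) (d : measure_display)
    (Omega : measurableType d) (mu : {measure set Omega -> \bar R})
    (f g : Omega -> R[i]) :
  measurable_cfun f -> measurable_cfun g ->
  (\int[mu]_w (rnorm (f w) * rnorm (g w))%:E <= L2norm mu f * L2norm mu g)%E.
Proof.
move=> mf mg.
have two_conj : 2^-1 + 2^-1 = 1 :> R by rewrite [RHS]splitr div1r.
have := hoelder mu (measurable_rnorm mf) (measurable_rnorm mg)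
  (ltr0n _ 2) (ltr0n _ 2) two_conj.
rewrite Lnorm1; apply: le_trans; rewrite le_eqVlt; apply/orP; left; apply/eqP.
by apply: eq_integral => w _ /=; rewrite ger0_norm// mulr_ge0 ?rnorm_ge0.
Qed.

Lemma L2_integrableCM (R : realType) (d : measure_display)
    (Omega : measurableType d) (mu : {measure set Omega -> \bar R})
    (f g : Omega -> R[i]) :
  L2 mu f -> L2 mu g -> integrableC mu (fun w => f w * g w).
Proof.
move=> [mf f2] [mg g2]; have mfg := measurable_cfunM mf mg.
split => //; apply/integrableP; split.
  by apply/measurable_EFinP; exact: measurable_rnorm.
have -> : (\int[mu]_w `|(rnorm (f w * g w))%:E| =
    \int[mu]_w (rnorm (f w) * rnorm (g w))%:E)%E.
  by apply: eq_integral => w _; rewrite gee0_abs ?lee_fin ?rnorm_ge0// rnormM.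
apply: (le_lt_trans (integral_rnormM_le mu mf mg)).
by rewrite lte_mul_pinfty ?Lnorm_ge0// ge0_fin_numE ?Lnorm_ge0.
Qed.

Unset Implicit Arguments.
Set Strict Implicit.

(** * Error of the transformed interpolant *)

Theorem proposition6p4 (R : realType) (d : measure_display)
    (Omega : measurableType d) (mu : {measure set Omega -> \bar R})
    (W : set Omega) (X : Type)
    (H : completeNormedModType R[i]) (ip : {dot H for (@Num.conj R[i])})
    (ev : H -> Omega -> R[i]) (G : Omega -> Omega -> R[i])
    (k : X -> Omega -> R[i]) (PW : Omega -> R)
    (hG : rkhs ip ev G)
    (hemb : continuously_embedded mu ev)
    (hk : forall x : X, L2 mu (k x))
    (hPW : power_function ip ev G W PW)
    (hPW2 : L2 mu (fun w => (PW w)%:C))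
    (a aW : H) (haW : min_norm_interpolator ev G W a aW) (x : X) :
  ((rnorm (integral_transform mu k (ev a) x
           - integral_transform mu k (ev aW) x))%:E
   <= (rnorm a)%:E * L2norm mu (fun w => (PW w)%:C) * L2norm mu (k x))%E.
Proof.
have [evL2 _] := hemb; have [mk _] := hk x; have [mP _] := hPW2.
have iak := L2_integrableCM (evL2 a) (hk x).
have iaWk := L2_integrableCM (evL2 aW) (hk x).
have [mak _] := iak; have [maWk _] := iaWk.
have rP w : rnorm (PW w)%:C = PW w.
  have [_ _ /(_ w) [P0 _]] := hPW.
  by apply: complexI; rewrite real_complex_rnorm ger0_norm ?ler0c.
have bound w : rnorm (ev a w * k x w - ev aW w * k x w) <=
    rnorm a * (rnorm (PW w)%:C * rnorm (k x w)).
  rewrite -mulrBl rnormM mulrA ler_wpM2r ?rnorm_ge0// rP.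
  exact: (power_function_bound hG hPW haW w).
have mB := measurable_cfunB mak maWk.
have iPk := L2_integrableCM hPW2 (hk x).
have mPk : measurable_fun setT
    (fun w => (rnorm (PW w)%:C * rnorm (k x w))%:E).
  by apply/measurable_EFinP; apply: measurable_funM; exact: measurable_rnorm.
rewrite /integral_transform integralCB//.
have iB : integrableC mu
    (fun w => ev a w * k x w - ev aW w * k x w).
  split => //; apply: (@le_integrable _ _ _ _ _ _ _
    (fun w => (rnorm a * rnorm ((PW w)%:C * k x w))%:E)) => //.
  - by apply/measurable_EFinP; exact: measurable_rnorm.
  - move=> w _; rewrite lee_fin !ger0_norm ?mulr_ge0 ?rnorm_ge0//.
    by rewrite rnormM.
  - by have [_ /(integrableZl measurableT (rnorm a))] := iPk.
apply: (le_trans (le_rnorm_integralC iB)).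
apply: (@le_trans _ _ ((rnorm a)%:E *
    \int[mu]_w (rnorm (PW w)%:C * rnorm (k x w))%:E)%E); last first.
  rewrite -muleA lee_wpmul2l ?lee_fin ?rnorm_ge0//.
  exact: integral_rnormM_le.
rewrite -ge0_integralZl_EFin ?rnorm_ge0//; last first.
  by move=> w _; rewrite lee_fin mulr_ge0 ?rnorm_ge0.
apply: ge0_le_integral => //.
- by move=> w _; rewrite lee_fin rnorm_ge0.
- by apply/measurable_EFinP; exact: measurable_rnorm.
- exact: measurable_funeM.
- by move=> w _; rewrite -EFinM lee_fin; exact: bound.
Qed.
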